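(* For all fixed integers $u,v\ge 1$, $\chi\left(\mathfrak{X}^{u,v}\right)$ is asymptotically (when $n\to+\infty$) a $\left(\tfrac12\delta_0+\tfrac12\mu_{\mathbb{C}\text{-}arc(2)}\right)$-distributed random variable, and for every fixed integer $v\geq 1$, $\chi\left(\mathfrak{X}^{0,v}\right)$ admits asymptotically (when $n\to+\infty$) the $*$-distribution $\tfrac12\delta_0+\tfrac12\mu_{arc(-2,2)}$. Moreover, the same holds for all $\chi\left(\left(\mathfrak{X}^{u,v}\right)^k\right)$ with $k\ge 1$ odd: for every fixed odd $k$, the limit is $\tfrac12\delta_0+\tfrac12\mu_{\mathbb{C}\text{-}arc(2)}$ if $u\ge 1$ and $\tfrac12\delta_0+\tfrac12\mu_{arc(-2,2)}$ if $u=0$.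
   Context: For $n\ge 2$, $\mathcal{A}_n=\bigoplus_{i,j\in\mathbb{Z}_n}\mathbb{C}e_{(i,j)}\oplus\mathcal{M}_n(\mathbb{C})$ is the multi-matrix $*$-algebra (usual multiplication and involution) underlying the Sekine finite quantum group $\mathbb{KP}_n$, with basis the minimal projections $e_{(i,j)}$, $i,j\in\mathbb{Z}_n$, and the matrix units $E_{i,j}$, $1\le i,j\le n$ of $\mathcal{M}_n(\mathbb{C})$ (indices of $E$ read modulo $n$); $\eta=e^{2\imath\pi/n}$. Its Haar state is \[h_n\left(\sum_{i,j\in\mathbb{Z}_n}x_{(i,j)}e_{(i,j)}+\sum_{i,j=1}^nX_{i,j}E_{i,j}\right)=\frac1{2n^2}\left(\sum_{i,j\in\mathbb{Z}_n}x_{(i,j)}+n\sum_{i=1}^nX_{i,i}\right).\] For $u\in\{0,\dots,n-1\}$ and $v\in\{1,\dots,\lfloor\frac{n-1}2\rfloor\}$, $\mathfrak{X}^{u,v}\in\mathcal{M}_2(\mathcal{A}_n)$ is the two-dimensional irreducible representation with entries \[\mathfrak{X}^{u,v}_{11}=\sum_{i,j\in\mathbb{Z}_n}\eta^{iu+jv}e_{(i,j)},\ \ \mathfrak{X}^{u,v}_{12}=\sum_{i=1}^n\eta^{-iv}E_{i,i+u},\ \ \mathfrak{X}^{u,v}_{21}=\sum_{i=1}^n\eta^{iv}E_{i,i+u},\ \ \mathfrak{X}^{u,v}_{22}=\sum_{i,j\in\mathbb{Z}_n}\eta^{iu-jv}e_{(i,j)}.\] Powers are taken in $\mathcal{M}_2(\mathcal{A}_n)$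 and $\chi(M)=\sum_iM_{ii}\in\mathcal{A}_n$. For fixed $u,v$ the representation exists for all sufficiently large $n$. Asymptotic distribution is convergence in $*$-moments: a sequence $x_n\in\mathcal{A}_n$ has asymptotic $*$-distribution $\mu$ (a probability measure on $\mathbb{C}$) if for every $m$ and $\varepsilon_1,\dots,\varepsilon_m\in\{\emptyset,*\}$, $h_n(x_n^{\varepsilon_1}\cdots x_n^{\varepsilon_m})\to\int z^{\varepsilon_1}\cdots z^{\varepsilon_m}\,d\mu(z)$ as $n\to\infty$, where $z^\emptyset=z$ and $z^*=\bar z$. $\delta_x$ is the Dirac mass at $x$. $\mu_{arc(-2,2)}$ is the arcsine distribution on $(-2,2)$, with density $\frac1{\pi\sqrt{4-x^2}}$. $\mu_{\mathbb{C}\text{-}arc(\alpha)}$ is the law on $\mathbb{C}$ of $re^{\imath\theta}$ where $(r,\theta)\in(0,\alpha)\times(0,2\pi)$ has density $\frac1{\pi^2\sqrt{\alpha^2-r^2}}$ with respect to $dr\,d\theta$. *)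

(* Defs.v *)
From HB Require Import structures.
From mathcomp Require Import all_boot all_order all_algebra.
From mathcomp Require Import complex.
From mathcomp Require Import all_classical all_reals all_analysis measurable_realfun.

Set Implicit Arguments.
Unset Strict Implicit.
Unset Printing Implicit Defensive.

Import Order.TTheory GRing.Theory Num.Theory.
Import numFieldNormedType.Exports.

Local Open Scope classical_set_scope.
Local Open Scope ring_scope.
Local Open Scope complex_scope.

(* e^(i t) *)
Definition expi (R : realType) (t : R) : R[i] := cos t +i* sin t.

(** * The Sekine algebra *)

(* For n >= 2, ['Z_n] is the ring of integers modulo n and
   [(Zp_trunc n).+2 = n]. The values n = 0, 1 denote 'Z_2 and are junk; they
   are irrelevant to limits as n tends to infinity.
   The matrix block is indexed by 'Z_n, the index n of the usual numbering
   1, ..., n being the residue 0. *)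
Definition Sekine (R : realType) (n : nat) : pzRingType :=
  ({ffun 'Z_n * 'Z_n -> R[i]} * 'M[R[i]]_((Zp_trunc n).+2))%type.

HB.instance Definition _ (R : realType) (n : nat) :=
  GRing.Lmodule.copy (GRing.PzRing.sort (Sekine R n))
    ({ffun 'Z_n * 'Z_n -> R[i]} * 'M[R[i]]_((Zp_trunc n).+2))%type.

Definition e_ (R : realType) (n : nat) (i j : 'Z_n) : Sekine R n :=
  ([ffun p => (p == (i, j))%:R], 0).

Definition E_ (R : realType) (n : nat) (i j : 'Z_n) : Sekine R n :=
  (0, delta_mx i j).

Arguments e_ R {n} i j.
Arguments E_ R {n} i j.

Definition sekine_star (R : realType) (n : nat) (x : Sekine R n) : Sekine R n :=
  ([ffun p => (x.1 p)^*], (map_mx (@conjc R) x.2)^T).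

Definition haar (R : realType) (n : nat) (x : Sekine R n) : R[i] :=
  (2 * n%:R ^+ 2)^-1 *
  ((\sum_(i : 'Z_n) \sum_(j : 'Z_n) x.1 (i, j)) + n%:R * \tr x.2).

Definition eta (R : realType) (n : nat) : R[i] := expi (2 * pi / n%:R).

Section Representation.
Variables (R : realType) (n u v : nat).
Local Notation eta := (eta R n).
Local Notation e_ := (e_ R).
Local Notation E_ := (E_ R).

Definition Xrep11 : Sekine R n :=
  \sum_(i : 'Z_n) \sum_(j : 'Z_n)
    eta ^ ((i * u)%N%:Z + (j * v)%N%:Z) *: e_ i j.

Definition Xrep12 : Sekine R n :=
  \sum_(i : 'Z_n) eta ^ (- (i * v)%N%:Z) *: E_ i (i + u%:R).

Definition Xrep21 : Sekine R n :=
  \sum_(i : 'Z_n) eta ^ ((i * v)%N%:Z) *: E_ i (i + u%:R).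

Definition Xrep22 : Sekine R n :=
  \sum_(i : 'Z_n) \sum_(j : 'Z_n)
    eta ^ ((i * u)%N%:Z - (j * v)%N%:Z) *: e_ i j.

(* This is an irreducible representation when u < n and
   1 <= v <= (n - 1) / 2; the formula is used as such for the finitely many
   other n. *)
Definition Xrep : 'M[Sekine R n]_2 :=
  \matrix_(a < 2, b < 2)
    if a == 0 then (if b == 0 then Xrep11 else Xrep12)
              else (if b == 0 then Xrep21 else Xrep22).

End Representation.

(** * The complex plane as a measurable space *)

Definition complex_coord (R : realType) (z : R[i]) : R * R := (complex.Re z, complex.Im z).

HB.instance Definition _ (R : realType) := isPointed.Build R[i] 0.

(* The Borel sigma-algebra of C, transported from R x R. *)
HB.instance Definition _ (R : realType) :=
  Measurable.copy R[i] (g_sigma_algebra_preimageType (@complex_coord R)).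

Lemma measurable_fun_complex d (T : measurableType d) (R : realType)
    (f : T -> R[i]) :
  measurable_fun setT (fun t => complex.Re (f t)) ->
  measurable_fun setT (fun t => complex.Im (f t)) -> measurable_fun setT f.
Proof.
move=> mRe mIm _ _ [B mB <-].
have := measurable_fun_pair mRe mIm measurableT mB.
by rewrite !setTI.
Qed.

(** * Convergence in *-moments *)

Section Moments.
Variables (R : realType) (mu : {measure set R[i] -> \bar R}) (f : R[i] -> R[i]).

Definition Cintegrable : Prop :=
  mu.-integrable setT (fun z => (complex.Re (f z))%:E) /\
  mu.-integrable setT (fun z => (complex.Im (f z))%:E).

Definition Cintegral : R[i] :=
  (\int[mu]_z complex.Re (f z)) +i* (\int[mu]_z complex.Im (f z)).

End Moments.

(* The word eps is encoded by booleans, [true] standing for the star. *)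
Definition star_word (A : pzRingType) (star : A -> A) (eps : seq bool) (x : A) :
    A :=
  \prod_(b <- eps) (if b then star x else x).

(* Convergence takes place in [R[i]^o], i.e. for the topology of the modulus. *)
Definition asymptotic_star_distribution (R : realType)
    (x : forall n, Sekine R n) (mu : {measure set R[i] -> \bar R}) : Prop :=
  mu setT = 1%E /\
  forall eps : seq bool,
    Cintegrable mu (star_word (@conjc R) eps) /\
    ((fun n => haar (star_word (@sekine_star R n) eps (x n))) : nat -> R[i]^o)
      @ \oo --> (Cintegral mu (star_word (@conjc R) eps) : R[i]^o).

(** * The limit laws *)

Section Density.
Context d (T : measurableType d) (R : realType).
Variables (mu : {measure set T -> \bar R}) (f : T -> R).
Hypotheses (mf : measurable_fun setT f) (f0 : forall x, 0 <= f x).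

Definition mdensity (A : set T) : \bar R := (\int[mu]_(x in A) (f x)%:E)%E.

Let mdensity0 : mdensity set0 = 0%E.
Proof. exact: integral_set0. Qed.

Let mdensity_ge0 A : (0 <= mdensity A)%E.
Proof. by apply: integral_ge0 => x _; rewrite lee_fin. Qed.

Let mdensity_sigma_additive : semi_sigma_additive mdensity.
Proof.
by apply: semi_sigma_additive_nng_induced => [|x];
  [exact/measurable_EFinP | rewrite lee_fin].
Qed.

HB.instance Definition _ := isMeasure.Build _ _ _ mdensity
  mdensity0 mdensity_ge0 mdensity_sigma_additive.

Definition density_measure : {measure set T -> \bar R} := mdensity.

End Density.

(* The library's [pushforward mu f], packaged with its measure structure. *)
Definition image_measure d d' (T : measurableType d) (T' : measurableType d')
    (R : realType) (mu : {measure set T -> \bar R}) (f : T -> T')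
    (mf : measurable_fun setT f) : {measure set T' -> \bar R} :=
  measure_function_pushforward__canonical__measure_function_Measure mu mf.


Lemma measurable_funV_ge0 d (T : measurableType d) (R : realType)
    (f : T -> R) :
  measurable_fun setT f -> (forall x, 0 <= f x) ->
  measurable_fun setT (fun x => (f x)^-1).
Proof.
move=> mf f0; rewrite (_ : (fun x => _) = (powR (R := R))^~ (-1) \o f).
  exact: measurableT_comp (measurable_powR _) mf.
by apply/funext => x /=; rewrite powR_inv1.
Qed.

Lemma measurable_sqrt (R : realType) :
  measurable_fun setT (@Num.sqrt R).
Proof.
rewrite (_ : @Num.sqrt R = (powR (R := R))^~ (2^-1) \o Num.max 0).
  apply: measurableT_comp (measurable_powR _) _.
  exact: measurable_maxr.
apply/funext => x /=; rewrite powR12_sqrt ?le_max ?lexx//.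
case: (leP 0 x) => [//|x0]; rewrite ?sqrtr0.
by rewrite ler0_sqrtr // ltW.
Qed.

Section Laws.
Variable R : realType.

Let measurable_arc_fun (a : R) :
  measurable_fun setT (fun x : R => Num.sqrt (a - x ^+ 2)).
Proof.
apply: measurableT_comp (@measurable_sqrt R) _.
by apply: measurable_funB => //; exact: measurable_funX.
Qed.

Definition arcsine_pdf : R -> R :=
  (fun x => (pi * Num.sqrt (4 - x ^+ 2))^-1) \_ `]-2, 2[.

Lemma arcsine_pdf_ge0 x : 0 <= arcsine_pdf x.
Proof.
rewrite /arcsine_pdf patchE; case: ifP => // _.
by rewrite invr_ge0 mulr_ge0 ?pi_ge0 ?sqrtr_ge0.
Qed.

Lemma measurable_arcsine_pdf : measurable_fun setT arcsine_pdf.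
Proof.
apply/(measurable_restrictT _ _).1 => //.
apply: measurable_funTS; apply: measurable_funV_ge0 => [|x].
  by apply: measurable_funM.
by rewrite mulr_ge0 ?pi_ge0 ?sqrtr_ge0.
Qed.

Definition arcsine : {measure set (measurableTypeR R) -> \bar R} :=
  density_measure lebesgue_measure measurable_arcsine_pdf arcsine_pdf_ge0.

Lemma measurable_real_complex :
  measurable_fun setT (real_complex R : measurableTypeR R -> R[i]).
Proof. by apply: measurable_fun_complex => /=. Qed.

(* The law mu_arc(-2,2) on the real line, seen as a law on C. *)
Definition arc_law : {measure set R[i] -> \bar R} :=
  image_measure arcsine measurable_real_complex.

(* The joint density of (r, theta), with respect to dr dtheta. *)
Definition carc_pdf (a : R) : R * R -> R :=
  (fun p => (pi ^+ 2 * Num.sqrt (a ^+ 2 - p.1 ^+ 2))^-1)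
    \_ (`]0, a[ `*` `]0, 2 * pi[).

Lemma carc_pdf_ge0 a p : 0 <= carc_pdf a p.
Proof.
rewrite /carc_pdf patchE; case: ifP => // _.
by rewrite invr_ge0 mulr_ge0 ?exprn_ge0 ?pi_ge0 ?sqrtr_ge0.
Qed.

Lemma measurable_carc_pdf a :
  measurable_fun setT
    (carc_pdf a : measurableTypeR R * measurableTypeR R -> R).
Proof.
apply/(measurable_restrictT _ _).1; first exact: measurableX.
apply: measurable_funTS; apply: measurable_funV_ge0 => [|x].
  apply: measurable_funM => //.
  exact: measurableT_comp (measurable_arc_fun _) measurable_fst.
by rewrite mulr_ge0 ?exprn_ge0 ?pi_ge0 ?sqrtr_ge0.
Qed.

Definition carc_polar (a : R) :
    {measure set (measurableTypeR R * measurableTypeR R) -> \bar R} :=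
  density_measure (lebesgue_measure \x lebesgue_measure)%E
    (@measurable_carc_pdf a) (@carc_pdf_ge0 a).

Definition polar (p : measurableTypeR R * measurableTypeR R) : R[i] :=
  (p.1)%:C * expi p.2.

Lemma measurable_polar : measurable_fun setT polar.
Proof.
have mc (f : R -> R) : continuous f -> measurable_fun setT
    (fun p : measurableTypeR R * measurableTypeR R => p.1 * f p.2).
  move=> cf; apply: measurable_funM; first exact: measurable_fst.
  apply: measurableT_comp measurable_snd.
  exact: continuous_measurable_fun.
apply: measurable_fun_complex.
- have := mc _ (@continuous_cos R); apply: eq_measurable_fun => p _ /=.
  by rewrite mul0r subr0.
- have := mc _ (@continuous_sin R); apply: eq_measurable_fun => p _ /=.
  by rewrite mul0r addr0.
Qed.

Definition carc_law (a : R) : {measure set R[i] -> \bar R} :=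
  image_measure (carc_polar a) measurable_polar.

(* 1/2 delta_0 + 1/2 mu *)
Definition half_atom0 (mu : {measure set R[i] -> \bar R}) :
    {measure set R[i] -> \bar R} :=
  measure_add (mscale (2^-1)%:nng (@dirac _ R[i] 0 R)) (mscale (2^-1)%:nng mu).

End Laws.

(* Main.v *)
Require Import Defs.
From HB Require Import structures.
From mathcomp Require Import all_boot all_order all_algebra.
From mathcomp Require Import complex.
From mathcomp Require Import all_classical all_reals all_analysis measurable_realfun.
From mathcomp Require Import ring lra zify.

Set Implicit Arguments.
Unset Strict Implicit.
Unset Printing Implicit Defensive.

Import Order.TTheory GRing.Theory Num.Theory.
Import numFieldNormedType.Exports.

Local Open Scope classical_set_scope.
Local Open Scope ring_scope.
Local Open Scope complex_scope.

(** Let X be the representation matrix. Its diagonal entries lie in the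
    commutative block of the Sekine algebra and its off-diagonal entries in the
    matrix block; the two blocks annihilate each other. Hence, for odd k, the
    k-th power is again diagonal on the commutative block and off-diagonal on
    the matrix block: its trace x has no matrix component, and its value at
    (i, j) is
      eta^(iku) (eta^(jkv) + eta^(-jkv)),
    a point of modulus 2|cos| of an equidistributed angle, rotated by another
    equidistributed angle when u > 0 and real when u = 0 ([tr_Xrep_odd]).

    A word with m letters, d more of them unstarred than starred, takes the
    value eta^(ikud) (eta^(jkv) + eta^(-jkv))^m at this point. The Haar state
    weighs the two blocks equally: the matrix block, where x vanishes,
    contributes the atom of mass 1/2 at 0, and the commutative block contributes
    half of the average over i and j ([haar_star_word]). Expanding the
    binomial and using that the powers of eta sum to 0 unless the exponent is
    divisible by n, this average is exactly c_m if d = 0 or u = 0, and 0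
    otherwise, as soon as n exceeds the modulus of every exponent that occurs; here
    c_m = C(m, m/2) for m even and 0 for m odd ([haar_tr_Xrep]). The sequences
    of moments are thus eventually constant.

    It remains to compute the moments of the limit laws. The substitution
    x = 2 sin t ([sin_substitution]) turns the m-th arcsine moment into the
    mean of (2 sin t)^m on (-pi/2, pi/2), which Wallis' recursion evaluates to
    c_m ([wallis_antiderivativeSS], [central_momentSS]). For the circular law
    the density is a product in polar coordinates: the angle contributes
    a factor that vanishes unless d = 0, and when d = 0 the number m is even,
    so that the radius contributes an even arcsine moment ([integral_carc],
    [carc_law_moment]). *)

(** * Words in z and its conjugate *)

(** The constant term of (z + 1/z)^m, which is the m-th moment of 2 cos of a
    uniform angle and hence of the arcsine law on (-2, 2). *)
Definition central_moment (m : nat) : nat := if odd m then 0%N else 'C(m, m./2).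

Definition word_degree (eps : seq bool) : int :=
  \sum_(b <- eps) (if b then -1 else 1).

(** The recursion satisfied by the integrals of (2 sin t)^m, on the side of
    the binomial coefficients. *)
Lemma central_momentSS m :
  (m.+2 * central_moment m.+2 = 4 * (m.+1 * central_moment m))%N.
Proof.
rewrite /central_moment /= negbK; case: ifPn => [_|modd]; first by rewrite !muln0.
have [p ->] : exists p, m = p.*2 by exists m./2; rewrite even_halfK.
rewrite doubleK.
have h1 : (p.+1 * 'C(p.*2.+2, p.+1) = p.*2.+2 * 'C(p.*2.+1, p))%N.
  by rewrite -mul_bin_diag.
have h2 : (p.+1 * 'C(p.*2.+1, p.+1) = p.*2.+1 * 'C(p.*2, p))%N.
  by rewrite -mul_bin_diag.
have h3 : ('C(p.*2.+1, p.+1) = 'C(p.*2.+1, p))%N.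
  rewrite -bin_sub; last by lia.
  by congr ('C(_, _)); lia.
rewrite h3 in h2.
move: h1 h2; move: 'C(_, _) 'C(_, _) 'C(_, _) => x y z h1 h2; nia.
Qed.

Lemma odd_word_degree (eps : seq bool) : odd `|word_degree eps|%N = odd (size eps).
Proof.
rewrite /word_degree; elim: eps => [|b l IH]; first by rewrite big_nil.
by rewrite big_cons /= -IH; move: (bigop.body _ _ _) {IH} => S; case: b; lia.
Qed.

Lemma word_degree_le_size (eps : seq bool) : (`|word_degree eps|%N <= size eps)%N.
Proof.
rewrite /word_degree; elim: eps => [|b l IH]; first by rewrite big_nil.
by rewrite big_cons /=; move: (bigop.body _ _ _) IH => S; case: b; lia.
Qed.

Section StarWord.
Variable R : realType.
Implicit Types (s w : R[i]) (eps : seq bool).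

(** Both sides of the limit are evaluated through this formula: the points of
    the spectrum and the points of the complex plane in polar coordinates are
    products of a real s and a unimodular w, and in a word the factors w and
    its conjugate 1/w cancel except for the degree. *)
Lemma star_word_conjM eps s w : s^* = s -> w != 0 -> w^* = w^-1 ->
  star_word (@conjc R) eps (s * w) = s ^+ size eps * w ^ word_degree eps.
Proof.
move=> sR w0 wU; rewrite /star_word /word_degree.
elim: eps => [|b eps IH]; first by rewrite !big_nil expr0 expr0z mulr1.
rewrite !big_cons IH /= expfzDr// exprS.
by case: b; rewrite ?rmorphM/= ?sR ?wU ?exprN1 ?expr1z; exact: mulrACA.
Qed.

Lemma star_word_conj0 eps : star_word (@conjc R) eps 0 = (eps == [::])%:R.
Proof.
case: eps => [|b eps]; rewrite /star_word ?big_nil// big_cons.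
by case: b; rewrite ?conjc0 mul0r.
Qed.

Lemma star_word_realM (x : R) (w : R[i]) (eps : seq bool) :
  w != 0 -> w^* = w^-1 ->
  star_word (@conjc R) eps (x%:C * w) = (x ^+ size eps)%:C * w ^ word_degree eps.
Proof. by move=> w0 wU; rewrite star_word_conjM ?conjc_real// rmorphXn. Qed.

Lemma star_word_real (x : R) (eps : seq bool) :
  star_word (@conjc R) eps x%:C = (x ^+ size eps)%:C.
Proof.
rewrite -[x%:C]mulr1 star_word_realM ?oner_eq0//.
  by rewrite exp1rz mulr1.
by rewrite conjc1 invr1.
Qed.

End StarWord.

(** * Roots of unity *)

Section Expi.
Variable R : realType.
Implicit Types t : R.

Lemma expi0 : expi (0 : R) = 1.
Proof. by rewrite /expi cos0 sin0. Qed.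

Lemma expiD t u : expi (t + u) = expi t * expi u.
Proof.
rewrite /expi cosD sinD; apply/eqP.
by rewrite eq_complex /= addrC [cos t * _ + _]addrC !eqxx.
Qed.

Lemma expiN t : expi (- t) = (expi t)^*.
Proof. by rewrite /expi cosN sinN. Qed.

Lemma expi_neq0 t : expi t != 0.
Proof.
apply/eqP => e; have := expiD t (- t).
by rewrite subrr expi0 e mul0r => /eqP; rewrite oner_eq0.
Qed.

Lemma expi_conj t : (expi t)^* = (expi t)^-1.
Proof.
apply: (mulfI (expi_neq0 t)); rewrite divff ?expi_neq0//.
by rewrite -expiN -expiD subrr expi0.
Qed.

Lemma expi_exp t (k : nat) : expi t ^+ k = expi (k%:R * t).
Proof.
elim: k => [|k IH]; first by rewrite expr0 mul0r expi0.
by rewrite exprS IH -expiD; congr expi; rewrite -natr1; ring.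
Qed.

Lemma expi_expz t (d : int) : expi t ^ d = expi (d%:~R * t).
Proof.
case: d => k; first by rewrite -exprnP expi_exp.
by rewrite NegzE -exprnN expi_exp -expi_conj -expiN -mulNr mulrNz.
Qed.

(** The half angle lies in (0, pi), where sin is positive, whereas cos t = 1
    forces sin (t / 2) = 0. *)
Lemma expi_neq1 t : 0 < t < 2 * pi -> expi t != 1.
Proof.
move=> /andP[t0 t2]; apply/eqP => -[ct _].
have : sin (t / 2) > 0 by apply: sin_gt0_pi; rewrite ?divr_gt0//; lra.
have := cos_mulr2n (t / 2); rewrite cos2sin2 (_ : t / 2 *+ 2 = t) ?ct; last first.
  by rewrite mulr2n; field.
rewrite mulr2n => e.
have -> : sin (t / 2) = 0 by apply/eqP; rewrite -sqrf_eq0; apply/eqP; lra.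
by rewrite ltxx.
Qed.
Lemma star_word_polar (p : R * R) (eps : seq bool) :
  star_word (@conjc R) eps (polar p) =
  (p.1 ^+ size eps * cos ((word_degree eps)%:~R * p.2)) +i*
  (p.1 ^+ size eps * sin ((word_degree eps)%:~R * p.2)).
Proof.
rewrite star_word_realM ?expi_neq0 ?expi_conj// expi_expz.
by apply/eqP; rewrite eq_complex/= !mul0r subr0 addr0 !eqxx.
Qed.

End Expi.

Section RootsOfUnity.
Variable R : realType.
Variable n : nat.
Hypothesis n2 : (2 <= n)%N.
Local Notation eta := (Defs.eta R n).

Let n0 : n%:R != 0 :> R. Proof. by rewrite pnatr_eq0; lia. Qed.

Lemma eta_conjz (a : int) : (eta ^ a)^* = eta ^ (- a).
Proof. by rewrite !expi_expz -expiN mulrNz mulNr. Qed.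

Lemma eta_prim : n.-primitive_root eta.
Proof.
apply/andP; split; first by lia.
apply/forallP => i; rewrite unity_rootE expi_exp.
have [->|/eqP ni] := eqVneq i.+1 n.
  rewrite [X in expi X](_ : _ = pi *+ 2); last by rewrite mulr2n; field.
  by rewrite /expi cos2pi sin2pi !eqxx.
rewrite (negPf (expi_neq1 _)); first by apply/eqP; lia.
have n_gt0 : 0 < n%:R :> R by rewrite ltr0n; lia.
have -> : i.+1%:R * (2 * pi / n%:R) = (i.+1%:R / n%:R) * (2 * pi) :> R by ring.
have pi_gt0 := pi_gt0 R.
rewrite mulr_gt0 ?divr_gt0 ?mulr_gt0 ?ltr0n//=.
rewrite gtr_pMl ?mulr_gt0// ltr_pdivrMr// mul1r ltr_nat.
  by have := ltn_ord i; lia.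
by lia.
Qed.

Lemma Zp_card : (Zp_trunc n).+2 = n. Proof. by rewrite Zp_cast. Qed.

(** Geometric sum: eta^a is a root of X^n - 1, and unless it equals 1 it is a
    root of 1 + X + ... + X^(n-1). *)
Lemma sum_eta_exp (a : int) :
  \sum_(i : 'Z_n) eta ^ (i%:Z * a) = (if (n %| `|a|)%N then n%:R else 0).
Proof.
under eq_bigr do rewrite mulrC -exprz_exp -exprnP.
have e1 : (eta ^ a) ^+ n = 1.
  by rewrite exprnP exprzAC -exprnP (prim_expr_order eta_prim) exp1rz.
case: ifP => [na|na].
  have -> : eta ^ a = 1.
    move: na; case: a {e1} => k /= na; last first.
      rewrite NegzE -exprnN; apply/eqP; rewrite invr_eq1.
      by rewrite -(prim_order_dvd eta_prim).
    by rewrite -exprnP; apply/eqP; rewrite -(prim_order_dvd eta_prim).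
  by under eq_bigr do rewrite expr1n; rewrite sumr_const card_ord Zp_card.
apply/eqP; have := subrX1 (eta ^ a) n; rewrite e1 subrr => /esym/eqP.
rewrite mulf_eq0 -!(big_mkord xpredT (fun i => (eta ^ a) ^+ i)) Zp_card => /orP[|//].
move=> h; exfalso; move: na; suff -> : (n %| `|a|)%N by [].
rewrite (prim_order_dvd eta_prim).
move: h; rewrite subr_eq0; case: a {e1} => k //=.
by rewrite NegzE -exprnN invr_eq1.
Qed.
End RootsOfUnity.

(** * Traces of odd powers and the Haar state *)

Section Traces.
Variable R : realType.
Variables n u v : nat.
Local Notation eta := (Defs.eta R n).
Local Notation X := (Xrep R n u v).

Lemma sekine_fst_sum (I : Type) (r : seq I) (F : I -> Sekine R n) p :
  (\sum_(i <- r) F i).1 p = \sum_(i <- r) (F i).1 p.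
Proof.
elim: r => [|i r IH]; first by rewrite !big_nil ffunE.
by rewrite !big_cons ffunE IH.
Qed.

Lemma sekine_snd_sum (I : Type) (r : seq I) (F : I -> Sekine R n) :
  (\sum_(i <- r) F i).2 = \sum_(i <- r) (F i).2.
Proof. by elim: r => [|i r IH]; rewrite ?big_nil// !big_cons -IH. Qed.

Lemma sekine_diag_fst (c : 'Z_n -> 'Z_n -> R[i]) (i j : 'Z_n) :
  (\sum_i \sum_j c i j *: e_ R i j).1 (i, j) = c i j.
Proof.
rewrite sekine_fst_sum; under eq_bigr do rewrite sekine_fst_sum.
rewrite (bigD1 i)//= [X in _ + X]big1 ?addr0 => [|k ki]; last first.
  by rewrite big1// => l _; rewrite !ffunE xpair_eqE eq_sym (negPf ki) scaler0.
rewrite (bigD1 j)//= big1 ?addr0 => [|k kj]; last first.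
  by rewrite !ffunE xpair_eqE [j == k]eq_sym (negPf kj) andbF scaler0.
by rewrite !ffunE eqxx; exact: mulr1.
Qed.

Lemma sekine_diag_snd (c : 'Z_n -> 'Z_n -> R[i]) :
  (\sum_i \sum_j c i j *: e_ R i j).2 = 0.
Proof.
rewrite sekine_snd_sum big1// => i _.
by rewrite sekine_snd_sum big1// => j _ /=; rewrite scaler0.
Qed.

Lemma sekine_matrix_fst (c : 'Z_n -> R[i]) (s : 'Z_n -> 'Z_n) p :
  (\sum_i c i *: E_ R i (s i)).1 p = 0.
Proof. by rewrite sekine_fst_sum big1// => i _; rewrite !ffunE scaler0. Qed.

(** Parity in a 2 x 2 matrix: changing the column exchanges the diagonal and
    the off-diagonal. *)
Lemma ord2_eq_neq (a b c : 'I_2) : c != b -> (a == c) = (a != b).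
Proof. by case: a b c => -[|[|//]] ? [[|[|//]] ?] [[|[|//]] ?]. Qed.

Lemma Xrep_fst (a b : 'I_2) (i j : 'Z_n) : (X a b).1 (i, j) =
  if a == b then eta ^ (i%:Z * u%:Z) * eta ^ ((-1) ^+ a * (j%:Z * v%:Z)) else 0.
Proof.
have eD p q : eta ^ (p + q) = eta ^ p * eta ^ q by rewrite expfzDr ?expi_neq0.
case: a b => -[|[|//]] ? [[|[|//]] ?]; rewrite mxE /=.
- by rewrite sekine_diag_fst eD expr0 mul1r !PoszM.
- exact: sekine_matrix_fst.
- exact: sekine_matrix_fst.
- by rewrite sekine_diag_fst eD expr1 mulN1r !PoszM.
Qed.

Lemma Xrep_diag_snd (a : 'I_2) : (X a a).2 = 0.
Proof.
by case: a => -[|[|//]] ?; rewrite mxE /=; exact: sekine_diag_snd.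
Qed.

(** On the commutative block X is diagonal, so its powers are computed
    entrywise. The sign (-1)^a distinguishes the two diagonal entries. *)
Lemma Xrep_expr_fst k (a b : 'I_2) (i j : 'Z_n) : ((X ^+ k) a b).1 (i, j) =
  if a == b then eta ^ (i%:Z * (k * u)%N%:Z) *
    eta ^ ((-1) ^+ a * (j%:Z * (k * v)%N%:Z)) else 0.
Proof.
elim: k b => [|k IH] b.
  by rewrite expr0 mxE; case: eqP => _; rewrite ffunE// !mul0n !mulr0 !expr0z mulr1.
rewrite exprSr mxE sekine_fst_sum (bigD1 a)//= big1 => [|c ca]; last first.
  by rewrite ffunE IH eq_sym (negPf ca) mul0r.
rewrite addr0 ffunE IH eqxx Xrep_fst; case: eqP => _; last by rewrite mulr0.
rewrite -!expfzDr ?expi_neq0//.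
by congr (eta ^ _); rewrite !mulSn !PoszD !PoszM; ring.
Qed.

(** On the matrix block X is off-diagonal, so its odd powers are off-diagonal
    and its even powers diagonal. *)
Lemma Xrep_expr_snd k (a b : 'I_2) : (a == b) = odd k -> ((X ^+ k) a b).2 = 0.
Proof.
elim: k b => [|k IH] b /=.
  by rewrite expr0 mxE => ->; rewrite mulr0n.
move=> abk; rewrite exprSr mxE sekine_snd_sum big1// => c _ /=.
have [->|cb] := eqVneq c b; first by rewrite Xrep_diag_snd mulr0.
by rewrite IH ?mul0r// (ord2_eq_neq _ cb) abk negbK.
Qed.

Lemma tr_Xrep_odd k : odd k ->
  (forall i j : 'Z_n, (\tr (X ^+ k)).1 (i, j) =
    eta ^ (i%:Z * (k * u)%N%:Z) *
    (eta ^ (j%:Z * (k * v)%N%:Z) + eta ^ (- (j%:Z * (k * v)%N%:Z)))) /\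
  (\tr (X ^+ k)).2 = 0.
Proof.
move=> ok; split=> [i j|].
  rewrite /mxtrace sekine_fst_sum !big_ord_recl big_ord0 addr0.
  rewrite !Xrep_expr_fst !eqxx mulrDr.
  by rewrite expr0 mul1r expr1 mulN1r.
rewrite /mxtrace sekine_snd_sum !big_ord_recl big_ord0 addr0.
by rewrite !Xrep_expr_snd ?eqxx ?ok// addr0.
Qed.

(** The unit of the algebra has Haar weight 1/2 on each block. On the matrix
    block the word is evaluated at 0, which matters for the empty word only;
    this is the source of the atom at 0. *)
Lemma haar_star_word (x : Sekine R n) eps : (2 <= n)%N -> x.2 = 0 ->
  haar (star_word (@sekine_star R n) eps x) =
  2^-1 * star_word (@conjc R) eps 0 +
  2^-1 * (n%:R ^- 2 *
    \sum_(i : 'Z_n) \sum_(j : 'Z_n) star_word (@conjc R) eps (x.1 (i, j))).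
Proof.
move=> n2 x0.
have w1 p : (star_word (@sekine_star R n) eps x).1 p =
    star_word (@conjc R) eps (x.1 p).
  rewrite /star_word; elim: eps => [|b eps IH].
    by rewrite !big_nil ffunE.
  by rewrite !big_cons ffunE IH; case: b => //=; rewrite ffunE.
have w2 : (star_word (@sekine_star R n) eps x).2 = (eps == [::])%:R.
  rewrite /star_word; case: eps {w1} => [|b eps]; first by rewrite big_nil.
  rewrite big_cons /=.
  have -> : (if b then sekine_star x else x).2 = 0.
    by case: b => //=; rewrite x0; apply/matrixP => i j; rewrite !mxE conjc0.
  exact: mul0r.
rewrite /haar w2; under eq_bigr do under eq_bigr do rewrite w1.
rewrite star_word_conj0.
have -> : \tr ((eps == [::])%:R : 'M[R[i]]_((Zp_trunc n).+2)) =
    (eps == [::])%:R * n%:R :> R[i].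
  case: eqP => _; last by rewrite mul0r; exact: mxtrace0.
  rewrite mul1r; transitivity ((Zp_trunc n).+2%:R : R[i]).
    exact: mxtrace1.
  by rewrite Zp_card.
have n0 : n%:R != 0 :> R[i] by rewrite pnatr_eq0; lia.
by field.
Qed.

(** In the binomial expansion the term of index i has exponent ja(m - 2i);
    since |a(m - 2i)| < n, its sum over j vanishes unless m = 2i. *)
Lemma sum_cos_power (a m : nat) : (2 <= n)%N -> (0 < a)%N -> (a * m < n)%N ->
  \sum_(j : 'Z_n) (eta ^ (j%:Z * a%:Z) + eta ^ (- (j%:Z * a%:Z))) ^+ m =
  n%:R * (central_moment m)%:R.
Proof.
move=> n2 a0 amn; under eq_bigr do rewrite exprDn.
rewrite exchange_big/=.
have term (i : nat) : (i <= m)%N ->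
    \sum_(j : 'Z_n) (eta ^ (j%:Z * a%:Z)) ^+ (m - i) *
      (eta ^ (- (j%:Z * a%:Z))) ^+ i *+ 'C(m, i) =
    (if (i.*2 == m)%N then n%:R * (central_moment m)%:R else 0).
  move=> im; rewrite sumrMnl.
  have e (j : 'Z_n) : (eta ^ (j%:Z * a%:Z)) ^+ (m - i) *
      (eta ^ (- (j%:Z * a%:Z))) ^+ i = eta ^ (j%:Z * (a%:Z * (m%:Z - i.*2%:Z))).
    rewrite !exprnP !exprz_exp -expfzDr ?expi_neq0//; congr (eta ^ _).
    by rewrite -subzn// -addnn PoszD; ring.
  under eq_bigr do rewrite e.
  rewrite sum_eta_exp// abszM.
  have [mi|/eqP mi] := eqVneq i.*2 m.
    rewrite -mi.
    by rewrite subrr muln0 dvdn0 /central_moment odd_double doubleK mulr_natr.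
  rewrite gtnNdvd ?mul0rn//.
    by rewrite muln_gt0 a0 absz_gt0; apply/eqP; lia.
  by apply: leq_ltn_trans amn; rewrite leq_mul2l; apply/orP; right; lia.
under eq_bigr => i _ do rewrite (term i (ltn_ord i)).
rewrite -big_mkcond/= /central_moment; case: ifPn => om.
  by rewrite mulr0 big1// => i /eqP mi; move: om; rewrite -mi odd_double.
have hm : (m./2 < m.+1)%N by lia.
rewrite (big_pred1 (Ordinal hm))// => i /=.
by rewrite -val_eqE /= -[X in _ == X](even_halfK om) -!muln2 eqn_pmul2r.
Qed.

End Traces.

Lemma haar_tr_Xrep (R : realType) (k u v : nat) (eps : seq bool) (n : nat) :
  odd k -> (0 < v)%N -> (2 <= n)%N ->
  (k * v * size eps < n)%N -> (k * u * size eps < n)%N ->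
  haar (star_word (@sekine_star R n) eps (\tr (Xrep R n u v ^+ k))) =
  2^-1 * star_word (@conjc R) eps 0 +
  2^-1 * (if (u == 0%N) || (word_degree eps == 0)
          then (central_moment (size eps))%:R else 0).
Proof.
move=> ok v0 n2 hv hu.
have [tr1 tr2] := tr_Xrep_odd R n u v ok.
rewrite haar_star_word//; congr (_ + 2^-1 * _).
set m := size eps; set d := word_degree eps.
transitivity (n%:R ^- 2 *
  ((\sum_(i : 'Z_n) Defs.eta R n ^ (i%:Z * ((k * u)%N%:Z * d))) *
   \sum_(j : 'Z_n) (Defs.eta R n ^ (j%:Z * (k * v)%N%:Z) +
                    Defs.eta R n ^ (- (j%:Z * (k * v)%N%:Z))) ^+ m)).
  congr (_ * _); rewrite big_distrl; apply: eq_bigr => i _.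
  rewrite big_distrr; apply: eq_bigr => j _ /=.
  rewrite tr1 mulrC star_word_conjM.
  - by rewrite exprz_exp mulrA mulrC.
  - by rewrite rmorphD/= !eta_conjz opprK addrC.
  - by rewrite expfz_neq0 ?expi_neq0.
  - by rewrite eta_conjz -invr_expz.
have n0 : n%:R != 0 :> R[i] by rewrite pnatr_eq0; lia.
have k0 : (0 < k)%N by case: (k) ok.
rewrite sum_cos_power ?muln_gt0 ?k0// sum_eta_exp// abszM.
have dm : (`|d| <= m)%N by exact: word_degree_le_size.
have -> : (n %| `|(k * u)%N| * `|d|)%N = (u == 0%N) || (d == 0).
  have [->|u0] /= := eqVneq u 0%N; first by rewrite muln0 mul0n dvdn0.
  have [->|d0] := eqVneq d 0; first by rewrite muln0 dvdn0.
  rewrite gtnNdvd// ?muln_gt0 ?absz_gt0 ?d0 ?k0 ?lt0n ?u0//.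
  by apply: leq_ltn_trans hu; rewrite leq_mul2l dm orbT.
by case: ifP => _; field.
Qed.

(** * Wallis integrals *)

Section Wallis.
Variable R : realType.

(** An antiderivative of (2 sin t)^m together with its increments: the increment
    over (-pi/2, pi/2) gives the arcsine moments, and for m even the increment
    over (0, pi/2) gives the moments of the radial part of the circular law. *)
Definition wallis_antiderivative (m : nat) (F : R -> R) : Prop :=
  [/\ forall t : R, is_derive t 1 F ((2 * sin t) ^+ m),
      F (pi / 2) - F (- (pi / 2)) = pi * (central_moment m)%:R &
      ~~ odd m -> F (pi / 2) - F 0 = pi / 2 * (central_moment m)%:R].

(** Integration by parts: the derivative of (2 sin t)^(m+1) 2 cos t is
    4(m+1)(2 sin t)^m - (m+2)(2 sin t)^(m+2), and the boundary terms vanish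
    because cos does at both ends of (-pi/2, pi/2), and sin does at 0. *)
Lemma wallis_antiderivativeSS m F : wallis_antiderivative m F ->
  wallis_antiderivative m.+2 (fun t =>
    (4 * m.+1%:R * F t - (2 * sin t) ^+ m.+1 * (2 * cos t)) / m.+2%:R).
Proof.
move=> [dF Fpi F0].
have m0 : m.+2%:R != 0 :> R by rewrite pnatr_eq0.
have ck : (m.+2%:R * (central_moment m.+2)%:R =
           4 * (m.+1%:R * (central_moment m)%:R) :> R).
  by rewrite -!natrM central_momentSS !natrM.
have {}ck : (central_moment m.+2)%:R =
    4 * m.+1%:R * (central_moment m)%:R / m.+2%:R :> R.
  by apply: (mulfI m0); rewrite ck; field.
split=> [t| |em].
- have dS : is_derive t 1 ((fun t : R => 2 * sin t) ^+ m.+1)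
      ((m.+1%:R * (2 * sin t) ^+ m) *: (2 * cos t)).
    by apply: is_deriveX; apply: is_derive_eq.
  have dS' : is_derive t 1 (fun t : R => (2 * sin t) ^+ m.+1)
      (m.+1%:R * (2 * sin t) ^+ m * (2 * cos t)).
    rewrite (_ : (fun t : R => _) = (fun t : R => 2 * sin t) ^+ m.+1) //.
    by apply/funext => x; rewrite fctE.
  have dFt := dF t.
  apply: is_derive_eq.
  rewrite /GRing.scale/=.
  have c2 : cos t * cos t = 1 - sin t * sin t by have := cos2sin2 t; rewrite !expr2.
  rewrite !mulr0 add0r !exprS; apply: (mulfI m0); rewrite mulVKf//.
  move: ((2 * sin t) ^+ m) => y.
  rewrite [LHS](_ : _ = 4 * m.+1%:R * y + 4 * (sin t * sin t) * y -
    4 * m.+1%:R * y * (cos t * cos t)); last by ring.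
  by rewrite c2 -(natr1 m.+1); ring.
- rewrite cosN cos_pihalf !mulr0 !subr0 -mulrBl -mulrBr Fpi.
  rewrite -[RHS]/(pi * (central_moment m.+2)%:R) ck.
  by ring.
- rewrite cos_pihalf sin0 !mulr0 expr0n/= mul0r !subr0 -mulrBl -mulrBr F0; last first.
    by rewrite /= negbK in em.
  rewrite -[RHS]/(pi / 2 * (central_moment m.+2)%:R) ck.
  by ring.
Qed.

Lemma exists_wallis_antiderivative (m : nat) : exists F, wallis_antiderivative m F.
Proof.
suff [] : (exists F, wallis_antiderivative m F) /\
    exists F, wallis_antiderivative m.+1 F by [].
elim: m => [|k [[F WF] Wk1]]; last first.
  by split => //; eexists; exact: wallis_antiderivativeSS WF.
split.
- exists id; split => [t| |_].
  + by rewrite expr0; exact: is_derive_id.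
  + by rewrite mulr1; lra.
  + by rewrite mulr1 subr0.
- exists (fun t => - 2 * cos t); split => // [t|].
    rewrite expr1; apply: is_derive_eq.
    by rewrite /GRing.scale/=; ring.
  by rewrite cosN cos_pihalf !mulr0 subrr.
Qed.

End Wallis.

(** * The substitution x = 2 sin t *)

Section Substitution.
Variable R : realType.
Local Notation mu := (@lebesgue_measure R).

(** Away from the endpoints -2 and 2 the integrand is continuous, and
    sqrt(4 - x^2) = 2 cos t is the derivative of x = 2 sin t. *)
Lemma sin_substitution_closed (h : R -> R) (a b : R) :
  continuous h -> - (pi / 2) < a -> a <= b -> b < pi / 2 ->
  (\int[mu]_(x in `[(2 * sin a)%R, (2 * sin b)%R]) (h x / Num.sqrt (4 - x ^+ 2))%:E =
   \int[mu]_(t in `[a, b]) (h (2 * sin t))%:E)%E.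
Proof.
move=> ch a1 ab b1.
pose F (t : R) := 2 * sin t.
have dF (t : R) : is_derive t 1 F (2 * cos t).
  by apply: is_derive_eq.
have F'E : F^`()%classic = (fun t => 2 * cos t).
  by apply/funext => t; rewrite derive1E (@derive_val _ _ _ _ _ _ _ (dF t)).
have cF' : continuous F^`()%classic.
  by rewrite F'E => t; apply: cvgM; [exact: cvg_cst|exact: continuous_cos].
have sF : {in `[- (pi / 2), pi / 2] &, {mono F : x y / x < y}}.
  by move=> x y xI yI; rewrite /F ltr_pM2l// ltr_sin.
have sub t : a <= t -> t <= b -> t \in `[- (pi / 2), pi / 2].
  by move=> at_ tb; rewrite in_itv/=; apply/andP; split; lra.
have cb t : a <= t <= b -> 0 < cos t.
  by move=> /andP[at_ tb]; apply: cos_gt0_pihalf; apply/andP; split; lra.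
rewrite (@integration_by_substitution_increasing _ F
  (fun x => h x / Num.sqrt (4 - x ^+ 2)) a b)//.
- apply: eq_integral => t; rewrite inE/= in_itv/= => tab.
  congr EFin; rewrite !fctE F'E /F.
  have -> : 4 - (2 * sin t) ^+ 2 = (2 * cos t) ^+ 2.
    by rewrite !exprMn [cos t ^+ 2]cos2sin2; ring.
  rewrite sqrtr_sqr ger0_norm ?mulr_ge0 ?(ltW (cb _ _))//.
  by rewrite mulfVK// mulf_neq0// gt_eqF// cb.
- by move=> x y xI yI xy; rewrite sF ?sub ?(itvP xI) ?(itvP yI).
- by apply: cvgP; apply: cvg_at_right_filter; exact: cF'.
- by apply: cvgP; apply: cvg_at_left_filter; exact: cF'.
- have cF : continuous F.
    by move=> x; apply: cvgM; [exact: cvg_cst|exact: continuous_sin].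
  split.
  + by move=> x _; have [] := dF x.
  + by apply: cvg_at_right_filter; exact: cF.
  + by apply: cvg_at_left_filter; exact: cF.
- apply: continuous_in_subspaceT => x; rewrite inE/= in_itv/= => /andP[xa xb].
  have : 0 < 4 - x ^+ 2.
    have pi0 := pi_gt0 R.
    have : F (- (pi / 2)) < x.
      by apply: lt_le_trans xa; rewrite sF ?(sub a)// in_itv/=; apply/andP; split; lra.
    have : x < F (pi / 2).
      by apply: le_lt_trans xb _; rewrite sF ?(sub b)// in_itv/=; apply/andP; split; lra.
    rewrite /F sinN sin_pihalf => x1 x2; nra.
  move=> x4.
  have c4 : {for x, continuous (fun y : R => Num.sqrt (4 - y ^+ 2))}.
    apply: continuous_comp; last exact: sqrt_continuous.
    by apply: cvgB; [exact: cvg_cst|exact: exprn_continuous].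
  apply: cvgM; first exact: ch.
  apply: cvgV; last exact: c4.
  by rewrite gt_eqF// sqrtr_gt0.
Qed.

Lemma measurable_invsqrt : measurable_fun setT (fun x : R => (Num.sqrt (4 - x ^+ 2))^-1).
Proof.
apply: measurable_funV_ge0 => [|x]; last exact: sqrtr_ge0.
apply: measurableT_comp (@measurable_sqrt R) _.
by apply: measurable_funB => //; exact: measurable_funX.
Qed.

Lemma mem_shrinking_itv (a b t : R) : a < t < b ->
  exists k : nat, a + (b - a) / 2 / k.+1%:R <= t <= b - (b - a) / 2 / k.+1%:R.
Proof.
move=> /andP[at_ tb].
pose d := Num.min (t - a) (b - t).
have d0 : 0 < d / ((b - a) / 2).
  by rewrite divr_gt0 ?divr_gt0 ?lt_min ?subr_gt0 ?at_ ?tb//; lra.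
have [k _ /(_ k (leqnn k)) /= hk] := near_infty_natSinv_lt (PosNum d0).
exists k; move: hk; rewrite /= ltr_pdivlMr; last by lra.
rewrite mulrC => /ltW; rewrite le_min => /andP[h1 h2].
by move: (_ / k.+1%:R) h1 h2 => z h1 h2; apply/andP; split; lra.
Qed.

(** At the endpoints the integrand may be unbounded. The open interval is the
    increasing union of the closed intervals with ends a + e_k and b - e_k,
    and the substitution on these passes to the limit by monotone
    convergence. *)
Lemma sin_substitution_ge0 (h : R -> R) (a b : R) :
  continuous h -> (forall x, 0 <= h x) ->
  - (pi / 2) <= a -> a < b -> b <= pi / 2 ->
  (\int[mu]_(x in `](2 * sin a)%R, (2 * sin b)%R[) (h x / Num.sqrt (4 - x ^+ 2))%:E =
   \int[mu]_(t in `]a, b[) (h (2 * sin t))%:E)%E.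
Proof.
move=> ch h0 a1 ab b1.
(* The factor 1 / 2 keeps a + e k <= b - e k, from k = 0 on. *)
pose e (k : nat) : R := (b - a) / 2 / k.+1%:R.
have e0 k : 0 < e k by rewrite !divr_gt0// subr_gt0.
have eW k : e k <= (b - a) / 2.
  by rewrite ler_pdivrMr// ler_peMr ?ler1n// ?divr_ge0// subr_ge0 ltW.
have eS k l : (k <= l)%N -> e l <= e k.
  move=> kl; rewrite ler_pM2l ?divr_gt0 ?subr_gt0// lef_pV2 ?posrE//.
  by rewrite ler_nat ltnS.
pose F (t : R) := 2 * sin t.
have sF x y : - (pi / 2) <= x -> y <= pi / 2 -> x < y -> F x < F y.
  move=> xa yb xy; rewrite /F ltr_pM2l// ltr_sin// in_itv/=; apply/andP; split; lra.
have sFW x y : - (pi / 2) <= x -> y <= pi / 2 -> x <= y -> F x <= F y.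
  by move=> xa yb; rewrite le_eqVlt => /predU1P[->//|xy]; apply/ltW/sF.
pose A k := `[a + e k, b - e k]%classic.
pose B k := `[F (a + e k), F (b - e k)]%classic.
have UA : \bigcup_k A k = `]a, b[%classic.
  apply/seteqP; split=> [t [k _]|t] /=; rewrite /A/= !in_itv/=.
    by have := e0 k; move=> ? /andP[? ?]; apply/andP; split; lra.
  by move=> /mem_shrinking_itv[k hk]; exists k.
have UB : \bigcup_k B k = `]F a, F b[%classic.
  apply/seteqP; split=> [x [k _]|x] /=; rewrite /B/= !in_itv/=.
    have := e0 k; have := eW k; move=> ? ? /andP[h1 h2]; apply/andP; split.
      by apply: lt_le_trans h1; apply: sF; lra.
    by apply: le_lt_trans h2 _; apply: sF; lra.
  move=> /andP[xa xb].
  have x1 : -1 <= x / 2 <= 1.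
    have := sin_geN1 a; have := sin_le1 b; move: xa xb; rewrite /F => *.
    by apply/andP; split; lra.
  (* Surjectivity: asin provides the preimage, and monotonicity places it in
     the open interval. *)
  pose t := asin (x / 2).
  have Ft : F t = x by rewrite /F asinK ?in_itv//=; field.
  have t1 : - (pi / 2) <= t by exact: asin_geNpi2.
  have t2 : t <= pi / 2 by exact: asin_lepi2.
  have /mem_shrinking_itv[k /andP[k1 k2]] : a < t < b.
    apply/andP; split; rewrite ltNge; apply/negP => ta.
      by have := sFW t a t1 ltac:(lra) ta; rewrite Ft leNgt xa.
    by have := sFW b t ltac:(lra) t2 ta; rewrite Ft leNgt xb.
  exists k => //=; rewrite in_itv/= -{1 2}Ft.
  rewrite -/(e k) in k1 k2; have := e0 k; have := eW k => ? ?.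
  by apply/andP; split; apply: sFW => //; lra.
have ndA : nondecreasing_seq A.
  move=> k l kl; apply/subsetPset; apply: subset_itv; rewrite bnd_simp.
    by rewrite lerD2l eS.
  by rewrite lerD2l lerN2 eS.
have ndB : nondecreasing_seq B.
  move=> k l kl; have := eS _ _ kl; have := e0 k; have := e0 l; have := eW k; have := eW l => *.
  by apply/subsetPset; apply: subset_itv; rewrite bnd_simp; apply: sFW; lra.
have cF : continuous F.
  by move=> x; apply: cvgM; [exact: cvg_cst|exact: continuous_sin].
have cFh : continuous (fun t => h (F t)).
  by move=> x; apply: continuous_comp; [exact: cF|exact: ch].
have cA : (\int[mu]_(t in A k) (h (F t))%:E @[k --> \oo] -->
    \int[mu]_(t in \bigcup_k A k) (h (F t))%:E)%E.
  apply: (@ge0_nondecreasing_set_cvg_integral _ (measurableTypeR R) R) => //.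
  - by move=> k; exact: measurable_itv.
  - move=> k; apply: measurable_funTS; apply/measurable_EFinP.
    exact: continuous_measurable_fun.
  - by move=> k x _; rewrite lee_fin.
have cB : (\int[mu]_(x in B k) (h x / Num.sqrt (4 - x ^+ 2))%:E @[k --> \oo] -->
    \int[mu]_(x in \bigcup_k B k) (h x / Num.sqrt (4 - x ^+ 2))%:E)%E.
  apply: (@ge0_nondecreasing_set_cvg_integral _ (measurableTypeR R) R) => //.
  - by move=> k; exact: measurable_itv.
  - move=> k; apply: measurable_funTS; apply/measurable_EFinP.
    apply: measurable_funM; last exact: measurable_invsqrt.
    exact: continuous_measurable_fun.
  - by move=> k x _; rewrite lee_fin divr_ge0 ?sqrtr_ge0.
rewrite -UA -UB; apply: (cvg_unique _ cB) => //=.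
rewrite (_ : (fun k => _) = (fun k => \int[mu]_(t in A k) (h (F t))%:E)%E)//.
apply/funext => k; rewrite /B sin_substitution_closed//.
- by have := e0 k; lra.
- by have := eW k; lra.
- by have := e0 k; lra.
Qed.

Lemma continuous_max0 (f : R -> R) :
  continuous f -> continuous (fun x => Num.max (f x) 0).
Proof.
move=> cf; under eq_fun do rewrite maxr_absE subr0 addr0.
move=> x; apply: cvgM; last exact: cvg_cst.
by apply: cvgD; [|apply: cvg_norm]; exact: cf.
Qed.

(** A signed integral is by definition the difference of the integrals of the
    positive and negative parts, and the nonnegative case applies to each. *)
Lemma sin_substitution (h : R -> R) (a b : R) :
  continuous h -> - (pi / 2) <= a -> a < b -> b <= pi / 2 ->
  (\int[mu]_(x in `](2 * sin a)%R, (2 * sin b)%R[) (h x / Num.sqrt (4 - x ^+ 2))%:E =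
   \int[mu]_(t in `]a, b[) (h (2 * sin t))%:E)%E.
Proof.
move=> ch a1 ab b1; rewrite [LHS]integralE [RHS]integralE.
have cpos : continuous (fun x => Num.max (h x) 0).
  exact: continuous_max0.
have cneg : continuous (fun x => Num.max (- h x) 0).
  by apply: continuous_max0 => x; apply: cvgN; exact: ch.
have w0 x : 0 <= (Num.sqrt (4 - x ^+ 2))^-1 by rewrite invr_ge0 sqrtr_ge0.
congr (_ - _)%E.
- transitivity (\int[mu]_(x in `](2 * sin a)%R, (2 * sin b)%R[)
      (Num.max (h x) 0 / Num.sqrt (4 - x ^+ 2))%:E)%E; last first.
    rewrite (sin_substitution_ge0 cpos)//; first last.
      by move=> x; rewrite le_max lexx orbT.
    by apply: eq_integral => t _; rewrite funeposE -EFin_max.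
  apply: eq_integral => x _; rewrite funeposE -EFin_max; congr EFin.
  by rewrite maxr_pMl// mul0r.
- transitivity (\int[mu]_(x in `](2 * sin a)%R, (2 * sin b)%R[)
      (Num.max (- h x) 0 / Num.sqrt (4 - x ^+ 2))%:E)%E; last first.
    rewrite (sin_substitution_ge0 cneg)//; first last.
      by move=> x; rewrite le_max lexx orbT.
    by apply: eq_integral => t _; rewrite funenegE -EFinN -EFin_max.
  apply: eq_integral => x _; rewrite funenegE -EFinN -EFin_max; congr EFin.
  by rewrite maxr_pMl// mul0r mulNr.
Qed.

End Substitution.

(** * Arcsine moments and Fourier coefficients *)

Section Moments.
Variable R : realType.
Local Notation mu := (@lebesgue_measure R).

Lemma integral_itv_oo_derive (f F : R -> R) (a b : R) :
  a < b -> continuous f -> (forall t : R, is_derive t 1 F (f t)) ->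
  (\int[mu]_(t in `]a, b[) (f t)%:E = (F b - F a)%:E)%E.
Proof.
move=> ab cf dF.
have cF : continuous F.
  by move=> t; apply/differentiable_continuous/derivable1_diffP; have [] := dF t.
rewrite -(@integral_itv_bndoo _ a b _ true false); last first.
  by apply/measurable_EFinP/measurable_funTS; exact: continuous_measurable_fun.
rewrite (@continuous_FTC2 _ _ F)// ?EFinB//.
- by apply: continuous_subspaceT.
- split.
  + by move=> x _; have [] := dF x.
  + by apply: cvg_at_right_filter; exact: cF.
  + by apply: cvg_at_left_filter; exact: cF.
- by move=> t _; rewrite derive1E (@derive_val _ _ _ _ _ _ _ (dF t)).
Qed.

Lemma integral_sin_power (m : nat) (F : R -> R) (c a b : R) :
  wallis_antiderivative m F -> a < b ->
  (\int[mu]_(t in `]a, b[) (c * (2 * sin t) ^+ m)%:E = (c * (F b - F a))%:E)%E.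
Proof.
move=> [dF _ _] ab; rewrite mulrBr.
apply: (@integral_itv_oo_derive _ (fun t => c * F t)) => // t.
apply: cvgM; first exact: cvg_cst.
apply: (@continuous_comp _ _ _ (fun t : R => 2 * sin t) (fun x => x ^+ m)).
  by apply: cvgM; [exact: cvg_cst|exact: continuous_sin].
exact: exprn_continuous.
Qed.

Lemma continuous_cmonomial (c : R) (m : nat) : continuous (fun x : R => c * x ^+ m).
Proof. by move=> x; apply: cvgM; [exact: cvg_cst|exact: exprn_continuous]. Qed.

Lemma integral_arcsine_moment (m : nat) :
  (\int[mu]_(x in `](- 2)%R, 2%R[) (pi^-1 * x ^+ m / Num.sqrt (4 - x ^+ 2))%:E =
   (central_moment m)%:R%:E)%E.
Proof.
have [F WF] := exists_wallis_antiderivative R m; have pi0 := pi_gt0 R.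
have := @sin_substitution R (fun x => pi^-1 * x ^+ m) (- (pi / 2)) (pi / 2)
  (@continuous_cmonomial _ _) (lexx _) ltac:(lra) (lexx _).
rewrite sinN sin_pihalf mulr1 mulrN1 => ->.
rewrite (integral_sin_power _ WF); last lra.
by case: WF => _ -> _; rewrite mulKf// gt_eqF.
Qed.

Lemma integral_half_arcsine_moment (m : nat) : ~~ odd m ->
  (\int[mu]_(x in `]0%R, 2%R[) (pi^-1 * x ^+ m / Num.sqrt (4 - x ^+ 2))%:E =
   (2^-1 * (central_moment m)%:R)%:E)%E.
Proof.
move=> em; have [F WF] := exists_wallis_antiderivative R m; have pi0 := pi_gt0 R.
have := @sin_substitution R (fun x => pi^-1 * x ^+ m) 0 (pi / 2)
  (@continuous_cmonomial _ _) ltac:(lra) ltac:(lra) (lexx _).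
rewrite sin0 sin_pihalf mulr1 mulr0 => ->.
rewrite (integral_sin_power _ WF); last lra.
by case: WF => _ _ ->//; rewrite -mulrA mulKf// gt_eqF.
Qed.

Lemma cos_sin_2piz (d : int) :
  cos (d%:~R * (2 * pi)) = 1 :> R /\ sin (d%:~R * (2 * pi)) = 0 :> R.
Proof.
have pos (k : nat) :
    cos (k%:R * (2 * pi)) = 1 :> R /\ sin (k%:R * (2 * pi)) = 0 :> R.
  elim: k => [|k [IHc IHs]]; first by rewrite mul0r cos0 sin0.
  have e : pi *+ 2 = 2 * pi :> R by rewrite mulr2n; ring.
  by rewrite -natr1 mulrDl mul1r -e cosD2pi sinD2pi e.
case: d => k; first by have [] := pos k.
rewrite NegzE mulrNz mulNr cosN sinN.
by have [-> ->] := pos k.+1; rewrite oppr0.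
Qed.

(** Together with the sine integral below: the Fourier coefficients of the
    uniform law on the circle. *)
Lemma integral_circle_cos (d : int) :
  (\int[mu]_(t in `]0%R, (2 * pi)%R[) (pi^-1 * cos (d%:~R * t))%:E =
   (if d == 0 then 2 else 0)%:E)%E.
Proof.
have pi0 := pi_gt0 R; case: eqVneq => [->|d0].
  rewrite [RHS](_ : _ = (pi^-1 * (2 * pi) - pi^-1 * 0 : R)%:E); last first.
    by congr EFin; rewrite mulr0 subr0 mulrCA mulVf ?mulr1// gt_eqF.
  apply: (@integral_itv_oo_derive _ (fun t => pi^-1 * t)).
  - by rewrite mulr_gt0.
  - by move=> t; under eq_fun do rewrite mul0r; exact: cvg_cst.
  - by move=> t; rewrite mul0r cos0; apply: is_derive_eq.
have d0' : d%:~R != 0 :> R by rewrite intr_eq0.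
pose F t : R := pi^-1 * (sin (d%:~R * t) / d%:~R).
transitivity (F (2 * pi) - F 0)%:E; last first.
  by rewrite /F (cos_sin_2piz d).2 mulr0 sin0 mul0r subrr.
apply: integral_itv_oo_derive.
- by rewrite mulr_gt0.
- move=> t; apply: cvgM; first exact: cvg_cst.
  apply: continuous_comp; last exact: continuous_cos.
  by apply: cvgM; [exact: cvg_cst|exact: cvg_id].
- move=> t; apply: is_derive_eq; rewrite /GRing.scale/=.
  by move: (pi^-1) => c; field.
Qed.

Lemma integral_circle_sin (d : int) :
  (\int[mu]_(t in `]0%R, (2 * pi)%R[) (pi^-1 * sin (d%:~R * t))%:E = 0)%E.
Proof.
have pi0 := pi_gt0 R; have [->|d0] := eqVneq d 0.
  by under eq_integral do rewrite mul0r sin0 mulr0; rewrite integral0.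
have d0' : d%:~R != 0 :> R by rewrite intr_eq0.
pose F t : R := pi^-1 * (- cos (d%:~R * t) / d%:~R).
transitivity (F (2 * pi) - F 0)%:E; last first.
  by rewrite /F (cos_sin_2piz d).1 mulr0 cos0 subrr.
apply: integral_itv_oo_derive.
- by rewrite mulr_gt0.
- move=> t; apply: cvgM; first exact: cvg_cst.
  apply: continuous_comp; last exact: continuous_sin.
  by apply: cvgM; [exact: cvg_cst|exact: cvg_id].
- move=> t; apply: is_derive_eq; rewrite /GRing.scale/=.
  by move: (pi^-1) => c; field.
Qed.
End Moments.

(** * Integration against densities, images and products *)

Section Density.
Context d (T : measurableType d) (R : realType).
Variables (mu : {measure set T -> \bar R}) (w : T -> R).
Hypotheses (mw : measurable_fun setT w) (w0 : forall x, 0 <= w x).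
Local Notation nu := (density_measure mu mw w0).

Let integral_density_indic (E : set T) : measurable E ->
  (\int[nu]_x (\1_E x)%:E = \int[mu]_x ((\1_E x)%:E * (w x)%:E))%E.
Proof.
move=> mE; rewrite integral_indic//= setIT [LHS]integral_mkcond/=.
apply: eq_integral => x _; rewrite patchE indicE; case: ifPn => xE.
  by rewrite mul1e.
by rewrite mul0e.
Qed.

Import HBNNSimple.

Let integral_density_nnsfun (g : {nnsfun T >-> R}) :
  (\int[nu]_x (g x)%:E = \int[mu]_x ((g x)%:E * (w x)%:E))%E.
Proof.
under [LHS]eq_integral do rewrite fimfunE -fsumEFin//.
rewrite [LHS]ge0_integral_fsum//; last 2 first.
  - by move=> r; exact/measurable_EFinP/measurableT_comp.
  - by move=> n x _; rewrite EFinM nnfun_muleindic_ge0.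
under [RHS]eq_integral.
  move=> x xD; rewrite fimfunE -fsumEFin// muleC ge0_mule_fsumr; last first.
    by move=> r; rewrite EFinM nnfun_muleindic_ge0.
  over.
rewrite [RHS]ge0_integral_fsum//; last 2 first.
  - move=> r; apply: emeasurable_funM; first exact/measurable_EFinP.
    by apply/measurable_EFinP; do 2 apply/measurableT_comp => //.
  - move=> n x _; rewrite EFinM mule_ge0//; last by rewrite nnfun_muleindic_ge0.
    by rewrite lee_fin.
apply: eq_fsbigr => r rg.
have r0 : 0 <= r by move: rg => /set_mem[x _ <-].
rewrite integralZl_indic_nnsfun//= integral_density_indic//.
rewrite -ge0_integralZl//.
- by apply: eq_integral => x _; rewrite EFinM muleA muleC.
- by apply: emeasurable_funM; apply/measurable_EFinP => //; exact: measurable_indic.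
- by move=> x _; rewrite mule_ge0// lee_fin.
Qed.

Lemma ge0_integral_density (g : T -> \bar R) :
  measurable_fun setT g -> (forall x, 0 <= g x)%E ->
  (\int[nu]_x g x = \int[mu]_x (g x * (w x)%:E))%E.
Proof.
move=> mg g0; pose g_ := nnsfun_approx measurableT mg.
have cg x : EFin \o g_^~ x @ \oo --> g x by exact: cvg_nnsfun_approx.
transitivity (lim (\int[nu]_x (g_ n x)%:E @[n --> \oo])%E).
  rewrite -monotone_convergence//=.
  - by congr (integral _ _ _); apply/funext => x; apply/esym/cvg_lim => //; exact: cg.
  - by move=> n; exact/measurable_EFinP.
  - by move=> n x _; rewrite lee_fin.
  - by move=> x _ m n mn; rewrite lee_fin; exact/lefP/nd_nnsfun_approx.
under eq_fun do rewrite integral_density_nnsfun.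
rewrite -monotone_convergence//=.
- apply: eq_integral => x _; apply/cvg_lim => //.
  by apply: cvgeZr => //; exact: cg.
- by move=> n; apply: emeasurable_funM; exact/measurable_EFinP.
- by move=> n x _; rewrite mule_ge0// lee_fin.
- move=> x _ m n mn; rewrite lee_wpmul2r// ?lee_fin//.
  exact/lefP/nd_nnsfun_approx.
Qed.

Lemma integral_density (g : T -> R) : measurable_fun setT g ->
  (\int[nu]_x (g x)%:E = \int[mu]_x (g x * w x)%:E)%E.
Proof.
move=> mg; have mgE : measurable_fun setT (EFin \o g) by exact/measurable_EFinP.
rewrite [LHS]integralE [RHS]integralE; congr (_ - _)%E.
- rewrite ge0_integral_density//; last exact: measurable_funepos.
  apply: eq_integral => x _; rewrite !funeposE -!EFin_max -EFinM.
  by rewrite maxr_pMl// mul0r.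
- rewrite ge0_integral_density//; last exact: measurable_funeneg.
  apply: eq_integral => x _; rewrite !funenegE -!EFinN -!EFin_max -EFinM.
  by rewrite maxr_pMl// mul0r mulNr.
Qed.

(** A bound on g is required only on the support of the density, since the
    monomials integrated later are bounded there but not everywhere. *)
Lemma integrable_weighted (g : T -> R) (C : R) : measurable_fun setT g ->
  (forall x, w x != 0 -> `|g x| <= C) -> (\int[mu]_x (w x)%:E < +oo)%E ->
  mu.-integrable setT (fun x => (g x * w x)%:E).
Proof.
move=> mg gC woo.
have iw : mu.-integrable setT (EFin \o w).
  apply/integrableP; split; first exact/measurable_EFinP.
  by under eq_integral do rewrite gee0_abs ?lee_fin//.
apply: (le_integrable measurableT _ _ (integrableZl measurableT C iw)).
  by apply/measurable_EFinP; exact: measurable_funM.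
move=> x _; rewrite -EFinM lee_fin !normrM (ger0_norm (w0 x)).
have [->|wx] := eqVneq (w x) 0; first by rewrite !mulr0.
by rewrite ler_wpM2r//; apply: le_trans (gC _ wx) (ler_norm _).
Qed.

Lemma integrable_density (g : T -> R) (C : R) : measurable_fun setT g ->
  (forall x, w x != 0 -> `|g x| <= C) -> (\int[mu]_x (w x)%:E < +oo)%E ->
  nu.-integrable setT (EFin \o g).
Proof.
move=> mg gC woo; apply/integrableP; split; first exact/measurable_EFinP.
rewrite (@ge0_integral_density (fun x => `|(g x)%:E|)%E)//; last first.
  by apply: measurableT_comp => //; exact/measurable_EFinP.
have /integrableP[_] := integrable_weighted mg gC woo.
by under eq_integral do rewrite EFinM abseM [X in (_ * X)%E]gee0_abs ?lee_fin//.
Qed.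

End Density.

Lemma Cintegral_image d (T : measurableType d) (R : realType)
    (nu : {measure set T -> \bar R}) (phi : T -> R[i])
    (mphi : measurable_fun setT phi) (F : R[i] -> R[i]) :
  measurable_fun setT (fun z => complex.Re (F z)) ->
  measurable_fun setT (fun z => complex.Im (F z)) ->
  nu.-integrable setT (fun t => (complex.Re (F (phi t)))%:E) ->
  nu.-integrable setT (fun t => (complex.Im (F (phi t)))%:E) ->
  Cintegrable (image_measure nu mphi) F /\
  Cintegral (image_measure nu mphi) F =
    (\int[nu]_t complex.Re (F (phi t))) +i* (\int[nu]_t complex.Im (F (phi t))).
Proof.
move=> mr mi ir ii.
have mrE : measurable_fun setT (fun z => (complex.Re (F z))%:E) by exact/measurable_EFinP.
have miE : measurable_fun setT (fun z => (complex.Im (F z))%:E) by exact/measurable_EFinP.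
split; first by split; apply: integrable_pushforward => //; rewrite preimage_setT.
rewrite /Cintegral /Rintegral; congr (fine _ +i* fine _).
- by rewrite integral_pushforward//= preimage_setT.
- by rewrite integral_pushforward//= preimage_setT.
Qed.

Section ProductIntegral.
Context d1 d2 (T1 : measurableType d1) (T2 : measurableType d2) (R : realType).
Variables (m1 : {sigma_finite_measure set T1 -> \bar R})
  (m2 : {sigma_finite_measure set T2 -> \bar R}).
Variables (a : T1 -> R) (b : T2 -> R).
Hypotheses (ia : m1.-integrable setT (EFin \o a))
  (ib : m2.-integrable setT (EFin \o b)).

Lemma integral_prod :
  (\int[m1 \x m2]_p (a p.1 * b p.2)%:E =
   \int[m1]_x (a x)%:E * \int[m2]_y (b y)%:E)%E.
Proof.
have ma : measurable_fun setT a by have /measurable_int/measurable_EFinP := ia.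
have mb : measurable_fun setT b by have /measurable_int/measurable_EFinP := ib.
have mab : measurable_fun setT (fun p : T1 * T2 => (a p.1 * b p.2)%:E).
  apply/measurable_EFinP; apply: measurable_funM.
    exact: measurableT_comp ma measurable_fst.
  exact: measurableT_comp mb measurable_snd.
have fb := integrable_fin_num measurableT ib.
have iab : (m1 \x m2)%E.-integrable setT (fun p : T1 * T2 => (a p.1 * b p.2)%:E).
  apply/(integrable12ltyP m1 m2 mab).
  under eq_integral => x _.
    under eq_integral => y _ do rewrite /= normrM EFinM.
    rewrite ge0_integralZl//; last first.
      by apply/measurable_EFinP; exact: measurableT_comp.
    over.
  rewrite ge0_integralZr//.
  - move: ia ib => /integrableP[_ ia'] /integrableP[_ ib'].
    by rewrite lte_mul_pinfty// ?integral_ge0// ge0_fin_numE// integral_ge0.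
  - by apply/measurable_EFinP; exact: measurableT_comp.
  - exact: integral_ge0.
rewrite -(integral12_prod_meas1 iab) /fubini_F.
under eq_integral => x _.
  under eq_integral => y _ do rewrite /= EFinM.
  rewrite integralZl//; over.
by rewrite -(fineK fb) integralZr.
Qed.

End ProductIntegral.

(** * Measurability of words and the atom at 0 *)

Section Complex.
Variable R : realType.

Lemma measurable_complex_coord : measurable_fun setT (@complex_coord R).
Proof. by move=> _ B mB; rewrite setTI; exists B => //; rewrite setTI. Qed.

Lemma measurable_Re : measurable_fun setT (@complex.Re R).
Proof. exact: measurableT_comp measurable_fst measurable_complex_coord. Qed.

Lemma measurable_Im : measurable_fun setT (@complex.Im R).
Proof. exact: measurableT_comp measurable_snd measurable_complex_coord. Qed.

(** Real and imaginary parts of a word are polynomials in those of z. *)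
Lemma measurable_star_word (eps : seq bool) :
  measurable_fun setT (fun z => complex.Re (star_word (@conjc R) eps z)) /\
  measurable_fun setT (fun z => complex.Im (star_word (@conjc R) eps z)).
Proof.
elim: eps => [|b eps [IHr IHi]].
  by under eq_fun do rewrite /star_word big_nil;
     under [X in _ /\ measurable_fun _ X]eq_fun do rewrite /star_word big_nil.
have mRe := measurable_Re; have mIm := measurable_Im.
have e z : star_word (@conjc R) (b :: eps) z =
    (complex.Re z +i* (if b then - complex.Im z else complex.Im z)) *
    star_word (@conjc R) eps z.
  by rewrite /star_word big_cons; case: b; case: z.
have mb : measurable_fun setT
    (fun z : R[i] => if b then - complex.Im z else complex.Im z).
  by case: b {e} => //; exact: measurable_funN.
split.
- rewrite (_ : (fun z => _) = (fun z => complex.Re z * complex.Re (star_word (@conjc R) eps z)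
    - (if b then - complex.Im z else complex.Im z) * complex.Im (star_word (@conjc R) eps z))).
    by apply: measurable_funB; exact: measurable_funM.
  by apply/funext => z; rewrite e; case: (star_word _ _ _).
- rewrite (_ : (fun z => _) = (fun z => complex.Re z * complex.Im (star_word (@conjc R) eps z)
    + (if b then - complex.Im z else complex.Im z) * complex.Re (star_word (@conjc R) eps z))).
    by apply: measurable_funD; exact: measurable_funM.
  by apply/funext => z; rewrite e; case: (star_word _ _ _).
Qed.

Section HalfAtom.
Variable nu : {measure set R[i] -> \bar R}.

(** The mixture acts on a function by averaging its value at 0 and its
    integral; the signed case below subtracts positive and negative parts. *)
Lemma ge0_integral_half_atom0 (g : R[i] -> \bar R) :
  measurable_fun setT g -> (forall z, 0 <= g z)%E ->
  (\int[half_atom0 nu]_z g z = 2^-1%:E * g 0%R + 2^-1%:E * \int[nu]_z g z)%E.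
Proof.
move=> mg g0; rewrite /half_atom0 ge0_integral_measure_add//.
by rewrite !ge0_integral_mscale// integral_dirac// diracT mul1e.
Qed.

Lemma integral_half_atom0 (g : R[i] -> R) :
  measurable_fun setT g -> nu.-integrable setT (EFin \o g) ->
  (half_atom0 nu).-integrable setT (EFin \o g) /\
  \int[half_atom0 nu]_z g z = 2^-1 * g 0 + 2^-1 * \int[nu]_z g z.
Proof.
move=> mg ig; have mgE : measurable_fun setT (EFin \o g) by exact/measurable_EFinP.
split.
  move: ig => /integrableP[_ ioo]; apply/integrableP; split => //.
  rewrite ge0_integral_half_atom0//; last exact: measurableT_comp.
  by rewrite lte_add_pinfty//= ?lte_mul_pinfty// ltry.
rewrite /Rintegral [in LHS]integralE [in RHS]integralE.
rewrite !ge0_integral_half_atom0//; [|exact: measurable_funeneg|exact: measurable_funepos].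
have ip := integrable_pos_fin_num measurableT ig.
have im := integrable_neg_fin_num measurableT ig.
rewrite !funeposE !funenegE -!EFin_max.
move: ip im; rewrite -[X in X \is a fin_num]/(\int[nu]_z ((EFin \o g)^\+ z))%E => ip im.
rewrite -(fineK ip) -(fineK im) -!EFinM -!EFinD.
have mx : Num.max (g 0) 0 - Num.max (- g 0) 0 = g 0.
  by case: (leP (g 0) 0) => g0; case: (leP (- g 0) 0) => g0'; lra.
by rewrite /= -[in RHS]mx; ring.
Qed.

Lemma half_atom0_moment (F : R[i] -> R[i]) :
  measurable_fun setT (fun z => complex.Re (F z)) ->
  measurable_fun setT (fun z => complex.Im (F z)) ->
  Cintegrable nu F ->
  Cintegrable (half_atom0 nu) F /\
  Cintegral (half_atom0 nu) F = 2^-1 * F 0 + 2^-1 * Cintegral nu F.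
Proof.
move=> mr mi [ir ii].
have [ir' er] := integral_half_atom0 mr ir.
have [ii' ei] := integral_half_atom0 mi ii.
split=> //; rewrite /Cintegral er ei.
have -> : 2^-1 = (2^-1 : R)%:C by rewrite fmorphV rmorph_nat.
case: (F 0) => x y; apply/eqP; rewrite eq_complex/=.
by rewrite !mul0r !subr0 !addr0 !eqxx.
Qed.

End HalfAtom.

End Complex.

(** * Moments of the limit laws *)

Section LimitLaws.
Variable R : realType.
Local Notation mu := (@lebesgue_measure R).

Lemma integral_arcsine_pdf (m : nat) :
  (\int[mu]_x (x ^+ m * arcsine_pdf x)%:E = (central_moment m)%:R%:E)%E.
Proof.
rewrite -integral_arcsine_moment [RHS]integral_mkcond/=.
apply: eq_integral => x _; rewrite /arcsine_pdf !patchE; case: ifPn => _.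
  by rewrite invfM mulrCA mulrA.
by rewrite mulr0.
Qed.

Lemma arc_law_moment (eps : seq bool) :
  Cintegrable (arc_law R) (star_word (@conjc R) eps) /\
  Cintegral (arc_law R) (star_word (@conjc R) eps) =
    (central_moment (size eps))%:R.
Proof.
have [mr mi] := measurable_star_word R eps.
have mX : measurable_fun setT (fun x : measurableTypeR R => x ^+ size eps).
  exact: measurable_funX.
have bnd (x : R) : arcsine_pdf x != 0 -> `|x ^+ size eps| <= 2 ^+ size eps.
  rewrite /arcsine_pdf patchE; case: ifPn => [|_]; last by rewrite eqxx.
  rewrite inE/= in_itv/= => /andP[x1 x2] _.
  by rewrite normrX lerXn2r ?nnegrE//= ler_norml; apply/andP; split; lra.
have pdfoo : (\int[mu]_x (arcsine_pdf x)%:E < +oo)%E.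
  have := integral_arcsine_pdf 0.
  by under eq_integral do rewrite expr0 mul1r; move=> ->; rewrite ltry.
have iX : (arcsine R).-integrable setT (EFin \o (fun x : R => x ^+ size eps)).
  exact: (@integrable_density _ (measurableTypeR R) R _ _ _ _ _ _ mX bnd pdfoo).
have [] := @Cintegral_image _ _ R (arcsine R) _ (@measurable_real_complex R) _ mr mi.
- by under eq_fun do rewrite star_word_real.
- under eq_fun do rewrite star_word_real; exact: integrable0.
move=> ic ->; split => //.
under eq_Rintegral do rewrite star_word_real.
under [X in _ +i* X]eq_Rintegral do rewrite star_word_real.
rewrite /Rintegral integral0 /= (@integral_density _ (measurableTypeR R) R _ _
  (@measurable_arcsine_pdf R) (@arcsine_pdf_ge0 R))//.
rewrite integral_arcsine_pdf/=.
by rewrite -[0]/(0 : R) -/(real_complex R _) rmorph_nat.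
Qed.

(** The density of (r, theta) as a product. The two factors have masses 1/2 and
    2: the radial one is the arcsine density cut to (0, 2). *)
Definition radial_pdf : R -> R := (fun x => (pi * Num.sqrt (4 - x ^+ 2))^-1) \_ `]0, 2[.
Definition angular_pdf : R -> R := (fun=> pi^-1) \_ `]0, 2 * pi[.

Lemma carc_pdfE (p : R * R) : carc_pdf 2 p = radial_pdf p.1 * angular_pdf p.2.
Proof.
rewrite /carc_pdf /radial_pdf /angular_pdf !patchE in_setX.
case: ifPn => [/andP[-> ->]|].
  by rewrite -invfM; congr (_^-1); rewrite expr2 -natrX; ring.
by rewrite negb_and => /orP[] /negPf ->; rewrite ?mul0r ?mulr0.
Qed.

Lemma measurable_radial_pdf : measurable_fun setT (radial_pdf : measurableTypeR R -> R).
Proof.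
apply/(measurable_restrictT _ _).1; first exact: measurable_itv.
apply: measurable_funTS; rewrite (_ : (fun x => _) =
    (fun x : R => pi^-1 * (Num.sqrt (4 - x ^+ 2))^-1)); last first.
  by apply/funext => x; rewrite invfM.
by apply: measurable_funM; [exact: measurable_cst|exact: measurable_invsqrt].
Qed.

Lemma integral_radial_pdf (m : nat) : ~~ odd m ->
  (\int[mu]_x (x ^+ m * radial_pdf x)%:E = (2^-1 * (central_moment m)%:R)%:E)%E.
Proof.
move=> em; rewrite -integral_half_arcsine_moment// [RHS]integral_mkcond/=.
apply: eq_integral => x _; rewrite /radial_pdf !patchE; case: ifPn => _.
  by rewrite invfM mulrCA mulrA.
by rewrite mulr0.
Qed.

Lemma radial_pdf_ge0 x : 0 <= radial_pdf x.
Proof.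
rewrite /radial_pdf patchE; case: ifP => // _.
by rewrite invr_ge0 mulr_ge0 ?pi_ge0 ?sqrtr_ge0.
Qed.

Lemma integrable_radial_pdf (m : nat) :
  mu.-integrable setT (EFin \o (fun x => x ^+ m * radial_pdf x)).
Proof.
apply: (@integrable_weighted _ (measurableTypeR R) R _ _ measurable_radial_pdf
  radial_pdf_ge0 (fun x => x ^+ m) (2 ^+ m)).
- exact: measurable_funX.
- move=> x; rewrite /radial_pdf patchE; case: ifPn => [|_]; last by rewrite eqxx.
  rewrite inE/= in_itv/= => /andP[x1 x2] _.
  by rewrite normrX lerXn2r ?nnegrE//= ler_norml; apply/andP; split; lra.
- rewrite [ltLHS](_ : _ = (2^-1 * (central_moment 0)%:R)%:E) ?ltry//.
  rewrite -integral_radial_pdf//.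
  by apply: eq_integral => x _; rewrite expr0 mul1r.
Qed.

Lemma measurable_angular_pdf : measurable_fun setT (angular_pdf : measurableTypeR R -> R).
Proof.
apply/(measurable_restrictT _ _).1; first exact: measurable_itv.
exact: measurable_cst.
Qed.

Lemma angular_pdf_ge0 x : 0 <= angular_pdf x.
Proof. by rewrite /angular_pdf patchE; case: ifP => // _; rewrite invr_ge0 pi_ge0. Qed.

Lemma integral_angular_pdf (f : R -> R) :
  (\int[mu]_x (f x * angular_pdf x)%:E =
   \int[mu]_(x in `]0%R, (2 * pi)%R[) (pi^-1 * f x)%:E)%E.
Proof.
rewrite [RHS]integral_mkcond/=.
apply: eq_integral => x _; rewrite /angular_pdf !patchE; case: ifPn => _.
  by rewrite mulrC.
by rewrite mulr0.
Qed.

Lemma integral_angular_pdf1 : (\int[mu]_x (angular_pdf x)%:E = 2%:E)%E.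
Proof.
rewrite -[RHS](integral_circle_cos R 0) -integral_angular_pdf.
by apply: eq_integral => x _; rewrite mul0r cos0 mul1r.
Qed.

Lemma integrable_angular_pdf (f : R -> R) : measurable_fun setT (f : measurableTypeR R -> R) ->
  (forall x, `|f x| <= 1) ->
  mu.-integrable setT (EFin \o (fun x => f x * angular_pdf x)).
Proof.
move=> mf f1.
apply: (@integrable_weighted _ (measurableTypeR R) R _ _ measurable_angular_pdf
  angular_pdf_ge0 f 1) => //.
by rewrite integral_angular_pdf1 ltry.
Qed.

Lemma integral_carc_pdf (m : nat) (f : R -> R) :
  measurable_fun setT (f : measurableTypeR R -> R) -> (forall x, `|f x| <= 1) ->
  (\int[mu \x mu]_p (p.1 ^+ m * f p.2 * carc_pdf 2 p)%:E =
   \int[mu]_x (x ^+ m * radial_pdf x)%:E * \int[mu]_t (f t * angular_pdf t)%:E)%E.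
Proof.
move=> mf f1.
rewrite -(integral_prod (integrable_radial_pdf m) (integrable_angular_pdf mf f1)).
by apply: eq_integral => p _; rewrite carc_pdfE mulrACA.
Qed.

Lemma integral_carc_pdf1 : (\int[mu \x mu]_p (carc_pdf 2 p)%:E = 1)%E.
Proof.
transitivity (\int[mu \x mu]_p (p.1 ^+ 0 * cst 1 p.2 * carc_pdf 2 p)%:E)%E.
  by apply: eq_integral => p _; rewrite expr0 !mul1r.
rewrite (@integral_carc_pdf 0 (cst 1))=> [|//|x]; last by rewrite normr1.
rewrite integral_radial_pdf//=; under eq_integral do rewrite mul1r.
by rewrite integral_angular_pdf1 -EFinM mulr1 mulVf.
Qed.

Lemma integrable_carc (m : nat) (f : R -> R) :
  measurable_fun setT (f : measurableTypeR R -> R) -> (forall x, `|f x| <= 1) ->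
  (carc_polar (2 : R)).-integrable setT (fun p => (p.1 ^+ m * f p.2)%:E).
Proof.
move=> mf f1.
apply: (@integrable_density _ (measurableTypeR R * measurableTypeR R)%type R
  _ _ _ _ (fun p => p.1 ^+ m * f p.2) (2 ^+ m)).
- apply: measurable_funM; last exact: measurableT_comp mf measurable_snd.
  exact: measurable_funX measurable_fst.
- move=> p; rewrite carc_pdfE mulf_eq0 negb_or => /andP[+ _].
  rewrite /radial_pdf patchE; case: ifPn => [|_]; last by rewrite eqxx.
  rewrite inE/= in_itv/= => /andP[x1 x2] _.
  rewrite normrM -[leRHS]mulr1 ler_pM// normrX lerXn2r ?nnegrE//= ler_norml.
  by apply/andP; split; lra.
- by rewrite integral_carc_pdf1 ltry.
Qed.

Lemma integral_carc (m : nat) (f : R -> R) :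
  measurable_fun setT (f : measurableTypeR R -> R) -> (forall x, `|f x| <= 1) ->
  (\int[carc_polar (2 : R)]_p (p.1 ^+ m * f p.2)%:E =
   \int[mu]_x (x ^+ m * radial_pdf x)%:E *
   \int[mu]_(t in `]0%R, (2 * pi)%R[) (pi^-1 * f t)%:E)%E.
Proof.
move=> mf f1.
rewrite (@integral_density _ (measurableTypeR R * measurableTypeR R)%type R
  _ _ (@measurable_carc_pdf R 2) (@carc_pdf_ge0 R 2)).
  by rewrite integral_carc_pdf// integral_angular_pdf.
apply: measurable_funM; last exact: measurableT_comp mf measurable_snd.
exact: measurable_funX measurable_fst.
Qed.

(** The angular factor vanishes unless the degree does. In that case the length
    m of the word is even, so that the radial factor, an integral over (0, 2),
    is half of the m-th arcsine moment. *)
Lemma carc_law_moment (eps : seq bool) :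
  Cintegrable (carc_law (2 : R)) (star_word (@conjc R) eps) /\
  Cintegral (carc_law (2 : R)) (star_word (@conjc R) eps) =
    if word_degree eps == 0 then (central_moment (size eps))%:R else 0.
Proof.
have [mr mi] := measurable_star_word R eps.
set m := size eps; set d := word_degree eps.
have mcos : measurable_fun setT ((fun t => cos (d%:~R * t)) : measurableTypeR R -> R).
  apply: continuous_measurable_fun => t; apply: continuous_comp; last exact: continuous_cos.
  by apply: cvgM; [exact: cvg_cst|exact: cvg_id].
have msin : measurable_fun setT ((fun t => sin (d%:~R * t)) : measurableTypeR R -> R).
  apply: continuous_measurable_fun => t; apply: continuous_comp; last exact: continuous_sin.
  by apply: cvgM; [exact: cvg_cst|exact: cvg_id].
have [] := @Cintegral_image _ _ R (carc_polar (2 : R)) _ (@measurable_polar R) _ mr mi.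
- under eq_fun do rewrite star_word_polar /=.
  by apply: (integrable_carc m mcos) => t; exact: cos_max.
- under eq_fun do rewrite star_word_polar /=.
  by apply: (integrable_carc m msin) => t; exact: sin_max.
move=> ic ->; split => //.
under eq_Rintegral do rewrite star_word_polar.
under [X in _ +i* X]eq_Rintegral do rewrite star_word_polar.
rewrite /Rintegral/= (integral_carc m mcos)=> [|t]; last exact: cos_max.
rewrite (integral_carc m msin)=> [|t]; last exact: sin_max.
rewrite integral_circle_cos integral_circle_sin mule0 /=.
rewrite -/(real_complex R _).
case: eqP => d0; last by rewrite mule0.
have em : ~~ odd m by rewrite /m -odd_word_degree -/d d0.
rewrite integral_radial_pdf// -EFinM /= mulrAC mulVf// mul1r.
exact: rmorph_nat.
Qed.

End LimitLaws.

(** * Convergence of the moments *)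

(** The moments of the trace are those of the mixture as soon as
    n > max(1, kv|eps|, ku|eps|), so that the convergence is that of an
    eventually constant sequence. The total mass is the moment of the empty
    word. *)
Lemma asymptotic_star_distribution_tr_Xrep (R : realType) (k u v : nat)
    (mu : {measure set R[i] -> \bar R}) :
  odd k -> (0 < v)%N ->
  (forall eps, Cintegrable mu (star_word (@conjc R) eps) /\
    Cintegral mu (star_word (@conjc R) eps) =
    if (u == 0%N) || (word_degree eps == 0)
          then (central_moment (size eps))%:R else 0) ->
  asymptotic_star_distribution (fun n => \tr (Xrep R n u v ^+ k)) (half_atom0 mu).
Proof.
move=> ok v0 H.
have M eps := half_atom0_moment (measurable_star_word R eps).1
  (measurable_star_word R eps).2 (H eps).1.
split.
  (* The real part of the moment of the empty word is the total mass, up to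
     fine; the value 1 excludes infinite mass. *)
  have [_] := M [::].
  rewrite (H [::]).2 {1}/Cintegral /star_word /word_degree !big_nil eqxx orbT.
  have -> : 2^-1 * 1 + 2^-1 * 1%:R = 1 :> R[i] by field.
  move=> /(congr1 (@complex.Re R)); rewrite -[RHS]/(1 : R) -[LHS]/(Rintegral _ _ _).
  under eq_Rintegral do rewrite big_nil.
  rewrite /Rintegral integral_cst// mul1e.
  case: (half_atom0 mu setT) => [r /= ->//| |] /= /esym/eqP; first by rewrite oner_eq0.
  by rewrite oner_eq0.
move=> eps; have [i ->] := M eps; split => //.
apply: cvg_near_cst.
near=> n.
rewrite haar_tr_Xrep// ?(H eps).2//.
all: near: n; exact: nbhs_infty_gt.
Unshelve. all: by end_near.
Qed.

Theorem theorem3p4 (R : realType) :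
  (forall u v : nat, (1 <= u)%N -> (1 <= v)%N ->
     asymptotic_star_distribution
       (fun n => \tr (Xrep R n u v)) (half_atom0 (carc_law (2 : R))))
  /\
  (forall v : nat, (1 <= v)%N ->
     asymptotic_star_distribution
       (fun n => \tr (Xrep R n 0 v)) (half_atom0 (arc_law R)))
  /\
  (forall k u v : nat, odd k -> (1 <= v)%N ->
     ((1 <= u)%N ->
        asymptotic_star_distribution
          (fun n => \tr (Xrep R n u v ^+ k)) (half_atom0 (carc_law (2 : R))))
     /\
     (u = 0%N ->
        asymptotic_star_distribution
          (fun n => \tr (Xrep R n u v ^+ k)) (half_atom0 (arc_law R)))).
Proof.
have carc k u v : odd k -> (0 < u)%N -> (0 < v)%N ->
    asymptotic_star_distribution
      (fun n => \tr (Xrep R n u v ^+ k)) (half_atom0 (carc_law (2 : R))).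
  move=> ok u0 v0; apply: asymptotic_star_distribution_tr_Xrep => // eps.
  by rewrite (negPf (lt0n_neq0 u0)); exact: carc_law_moment.
have arc k v : odd k -> (0 < v)%N ->
    asymptotic_star_distribution
      (fun n => \tr (Xrep R n 0 v ^+ k)) (half_atom0 (arc_law R)).
  move=> ok v0; apply: asymptotic_star_distribution_tr_Xrep => // eps.
  exact: arc_law_moment.
split; first by move=> u v u0 v0; have := carc 1%N u v isT u0 v0.
split; first by move=> v v0; have := arc 1%N v isT v0.
move=> k u v ok v0; split=> [u0|->]; first exact: carc.
exact: arc.
Qed.
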